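(* Let $\mathcal{H}=\mathcal{H}(X)$ be a reproducing kernel Hilbert space on a nonempty set $X$, let $A\in\mathcal{B}(\mathcal{H})^+$, and let $Z\in\mathcal{B}_A(\mathcal{H})$ have closed range, with the pairs $(A,\mathcal{R}(Z))$ and $(A,\mathcal{N}(Z))$ compatible. Let $Z^{\dagger_A}$ be an $A$-generalized inverse of $Z$. Then for every $\epsilon\in[0,1]$, $$\mathbf{ber}_A^2(Z)\leq \frac{1-\epsilon}{2}\,\mathbf{ber}_A^{\frac12}(Z^{\#_A}Z)\,\mathbf{ber}_A(Z^{\#_A}Z+ZZ^{\dagger_A})+\epsilon\,\mathbf{ber}_A(Z^{\#_A}Z).$$
   Context: A reproducing kernel Hilbert space $\mathcal{H}(X)$ is a complex Hilbert space of complex-valued functions on $X$ on which every evaluation $\phi\mapsto\phi(x)$, $x\in X$, is continuous; $k_x\in\mathcal{H}$ is the element with $\phi(x)=\langle\phi,k_x\rangle$ for all $\phi\in\mathcal{H}$. $\mathcal{B}(\mathcal{H})$ is the algebra of bounded linear operators on $\mathcal{H}$, $\mathcal{B}(\mathcal{H})^+=\{T\in\mathcal{B}(\mathcal{H}):\langle Tu,u\rangle\ge0\ \forall u\in\mathcal{H}\}$; $\mathcal{R}(T)$, $\mathcal{N}(T)$ denote range and null space. For $A\in\mathcal{B}(\mathcal{H})^+$: $\langle u,v\rangle_A=\langle Au,v\rangle$ and $\|u\|_A=\langle u,u\rangle_A^{1/2}$. $\mathcal{B}_A(\mathcal{H})=\{T\in\mathcal{B}(\mathcal{H}):\mathcal{R}(T^*A)\subseteq\mathcal{R}(A)\}$.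 For $T\in\mathcal{B}_A(\mathcal{H})$, $T^{\#_A}$ is the unique $Y\in\mathcal{B}(\mathcal{H})$ with $AY=T^*A$ and $\mathcal{R}(Y)\subseteq\overline{\mathcal{R}(A)}$; in particular $\langle Tu,v\rangle_A=\langle u,T^{\#_A}v\rangle_A$. For a closed subspace $V$, the pair $(A,V)$ is compatible if there is $Q\in\mathcal{B}(\mathcal{H})$ with $Q^2=Q$, $\mathcal{R}(Q)=V$, $AQ=Q^*A$. An $A$-generalized inverse of a closed-range operator $T$ is an operator $T^{\dagger_A}\in\mathcal{B}(\mathcal{H})$ with $TT^{\dagger_A}T=T$, $T^{\dagger_A}TT^{\dagger_A}=T^{\dagger_A}$, $ATT^{\dagger_A}=(TT^{\dagger_A})^*A$, $AT^{\dagger_A}T=(T^{\dagger_A}T)^*A$. (Known: it exists if and only if $(A,\mathcal{R}(T))$ and $(A,\mathcal{N}(T))$ are compatible.) The $A$-normalized reproducing kernel is $\hat k_x'=k_x/\|k_x\|_A$, for those $x\in X$ with $\|k_x\|_A\neq0$. The $A$-Berezin number is $\mathbf{ber}_A(T)=\sup_{x}|\langle T\hat k_x',\hat k_x'\rangle_A|$, the supremum being over $x\in X$ with $\|k_x\|_A\ne0$. $\mathbf{ber}_A^{p}(T)$ means $(\mathbf{ber}_A(T))^p$. *)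

(* Defs.v *)
From HB Require Import structures.
From mathcomp Require Import all_boot all_order all_algebra.
From mathcomp Require Import sesquilinear complex ring lra.
From mathcomp Require Import all_classical all_reals all_analysis.

Set Implicit Arguments.
Unset Strict Implicit.
Unset Printing Implicit Defensive.
Import Order.TTheory GRing.Theory Num.Theory.
Import numFieldNormedType.Exports.
Local Open Scope classical_set_scope.
Local Open Scope ring_scope.

(* Hilbert spaces over the complex numbers R[i]; the form is linear in its
   first argument and antilinear in its second. *)
HB.mixin Record isHilbert (R : realType) H & CompleteNormedModule R[i] H := {
  inner : {dot H for (@Num.conj R[i])};
  inner_norm : forall u : H, inner u u = `|u| ^+ 2 }.

#[short(type="hilbertType")]
HB.structure Definition Hilbert (R : realType) :=
  {H of isHilbert R H & CompleteNormedModule R[i] H}.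

(* The elements of H are functions on X: u : H stands for x |-> eval x u, which
   is linear in u (pointwise operations) and injective in u. *)
HB.mixin Record isRKHS (R : realType) (X : Type) H & Hilbert R H := {
  eval : X -> {linear H -> R[i]^o};
  eval_inj : forall u v : H, (forall x, eval x u = eval x v) -> u = v;
  eval_continuous : forall x, continuous (eval x) }.

#[short(type="rkhsType")]
HB.structure Definition RKHS (R : realType) (X : Type) :=
  {H of isRKHS R X H & Hilbert R H}.

Record bop (R : realType) (H : hilbertType R) := Bop {
  bop_fun :> {linear H -> H};
  bop_bounded : bounded_near bop_fun (nbhs (0 : H)) }.

Section HilbertTheory.
Variables (R : realType) (H : hilbertType R).
Local Open Scope complex_scope.
Implicit Types u v w : H.
Local Notation Re := complex.Re.

Let rn (u : H) : R := Re `|u|.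

Let rnE u : `|u| = (rn u)%:C.
Proof. by rewrite /rn RRe_real// ger0_real. Qed.

Let rn_ge0 u : 0 <= rn u.
Proof. by rewrite -ler0c -rnE. Qed.

Let ReDot u : Re (inner u u) = rn u ^+ 2.
Proof. by rewrite inner_norm rnE -rmorphXn. Qed.

Let innerC u v : inner u v = (inner v u)^*%C.
Proof. by rewrite (hermC inner u v) /= expr0 mul1r. Qed.

Let Re_innerC u v : Re (inner u v) = Re (inner v u).
Proof. by rewrite innerC; case: (inner v u). Qed.

Lemma inner_inj u v : (forall w, inner w u = inner w v) -> u = v.
Proof.
move=> e; apply/eqP; rewrite -subr_eq0 -normr_eq0 -sqrf_eq0 -inner_norm.
by rewrite linearBr /= e subrr.
Qed.

Lemma inner_CauchySchwarz u v : `|inner u v| <= `|u| * `|v|.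
Proof.
rewrite -(@ler_pXn2r _ 2)// ?nnegrE ?mulr_ge0// exprMn -!inner_norm.
have [->|v0] := eqVneq v 0; first by rewrite linear0r normr0 expr0n linear0r mulr0.
pose a := inner u v / inner v v; pose u1 := u - a *: v.
have ou : inner u1 v = 0.
  by rewrite linearBl/= linearZl_LR divfK ?dnorm_eq0 ?subrr.
have -> : inner u u = inner u1 u1 + inner (a *: v) (a *: v).
  have {1 2}-> : u = u1 + a *: v by rewrite subrK.
  by apply: hnormDd; rewrite linearZr_LR/= ou mulr0.
rewrite dnormZ /a normrM normfV mulrDl exprMn exprVn.
rewrite (ger0_norm (dnorm_ge0 _ v)).
have vv0 : inner v v != 0 by rewrite dnorm_eq0.
rewrite [X in _ <= _ + X](_ : _ = `|inner u v| ^+ 2); last by field.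
by rewrite lerDr mulr_ge0 ?dnorm_ge0.
Qed.

Let ReD (x y : R[i]) : Re (x + y) = Re x + Re y. Proof. by rewrite raddfD. Qed.
Let ReN (x : R[i]) : Re (- x) = - Re x. Proof. by rewrite raddfN. Qed.

Let ReqD u v : Re (inner (u + v) (u + v)) =
  rn u ^+ 2 + 2 * Re (inner u v) + rn v ^+ 2.
Proof.
rewrite linearDl /= 2!linearDr /= !ReD (Re_innerC v u) !ReDot; ring.
Qed.

Let Re_le_norm (z : R[i]) (b : R) : `|z| <= b%:C -> Re z <= b.
Proof.
move=> zb; rewrite (le_trans (ler_norm _))// -lecR.
exact: le_trans (normc_ge_Re z) zb.
Qed.

Lemma riesz_representation (f : {linear H -> R[i]^o}) :
  continuous f -> exists k, forall u, f u = inner u k.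
Proof.
move=> cf.
have [M M0 fM] : exists2 M : R, 0 < M & forall u, `|f u : R[i]| <= M%:C * `|u|.
  have /linear_boundedP : bounded_near f (nbhs 0) by apply/linear_bounded_continuous.
  move=> /pinfty_ex_gt0[M M0 fM]; exists (Re M) => [|u].
    by rewrite -ltcR RRe_real// gtr0_real.
  by rewrite RRe_real ?gtr0_real.
pose J u : R := Re (inner u u) - 2 * Re (f u).
have Jge u : - M ^+ 2 <= J u.
  have /Re_le_norm : `|f u : R[i]| <= (M * rn u)%:C by rewrite rmorphM/= -rnE.
  rewrite /J ReDot; have := sqr_ge0 (rn u - M); nra.
have Jpar u v w : w + w = u + v ->
    J u + J v - 2 * J w = 2^-1 * rn (u - v) ^+ 2.
  move=> wuv; have fw : Re (f w) + Re (f w) = Re (f u) + Re (f v).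
    by rewrite -!ReD -!linearD wuv.
  have := ReqD w w; rewrite wuv (ReqD u v) (ReDot w) => h1.
  have := ReqD u (- v); rewrite ReDot linearNr ReN /= => ->.
  have -> : rn (- v) = rn v by rewrite /rn normrN.
  rewrite /J !ReDot; lra.
pose E := range J.
have infE : has_inf E.
  by split; [exists (J 0), 0|exists (- M ^+ 2) => _ [u _ <-]].
pose m := inf E.
have mJ u : m <= J u by apply: ge_inf; [exact: infE.2|exists u].
pose S (e : R) := [set u | J u < m + e].
pose F := filter_from [set e : R | 0 < e] S.
have FF : ProperFilter F.
  apply: filter_from_proper; last first.
    by move=> e e0; have [_ [u _ <-] ?] := inf_adherent e0 infE; exists u.
  apply: filter_from_filter; first by exists 1; rewrite /= ltr01.
  move=> i j i0 j0; exists (Num.min i j); first by rewrite /= lt_min i0.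
  move=> u; rewrite /S/= => Ju; split; apply: (lt_le_trans Ju);
    by rewrite lerD2l ge_min lexx ?orbT.
have Scl r u v : 0 < r -> S (r ^+ 2 / 4) u -> S (r ^+ 2 / 4) v -> `|u - v| < r%:C.
  rewrite /S/= => r0 Su Sv; rewrite rnE ltcR.
  have := @Jpar u v (2^-1 *: (u + v)).
  rewrite -scalerDl -[X in X + X]mul1r -splitr scale1r => /(_ erefl).
  have := mJ (2^-1 *: (u + v)) => h1 h2.
  by rewrite -(@ltr_pXn2r _ 2)// ?nnegrE ?rn_ge0 ?(ltW r0)//; lra.
have cE (e : R[i]) : 0 < e -> exists2 r : R, 0 < r & e = r%:C.
  move=> e0; exists (Re e); last by rewrite RRe_real// gtr0_real.
  by rewrite -ltcR RRe_real// gtr0_real.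
have /cauchy_cvg/cvg_ex[k Fk] : cauchy F.
  apply: cauchy_exP => e /cE[r r0 ->].
  have r20 : 0 < r ^+ 2 / 4 by rewrite divr_gt0// exprn_gt0.
  have [_ [u _ <-] Su] := inf_adherent r20 infE.
  exists u; exists (r ^+ 2 / 4) => // v Sv.
  by rewrite -ball_normE/=; exact: Scl.
exists k => v; apply/eqP; rewrite -subr_eq0 -normr_le0.
pose d u : R[i] := f v - inner v u.
pose nd u := Re `|d u|.
have ndE u : `|d u| = (nd u)%:C by rewrite /nd RRe_real// ger0_real.
have nd0 u : 0 <= nd u by rewrite -ler0c -ndE.
have dS e u : S e u -> nd u ^+ 2 <= e * (rn v ^+ 2 + 1).
  rewrite /S/= => Su.
  pose s := (rn v ^+ 2 + 1)^-1.
  have q0 : 0 < rn v ^+ 2 + 1 by rewrite ltr_wpDl// sqr_ge0.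
  have sq : s * (rn v ^+ 2 + 1) = 1 by rewrite mulVf// gt_eqF.
  have s0 : 0 < s by rewrite invr_gt0.
  pose t : R[i] := s%:C * (d u)^*%C.
  have rt : rn (t *: v) ^+ 2 = s ^+ 2 * nd u ^+ 2 * rn v ^+ 2.
    rewrite -2!exprMn; congr (_ ^+ 2).
    rewrite /rn normrZ /t normrM normcJ ndE rnE ger0_norm ?ler0c ?ltW//.
    by rewrite -!rmorphM.
  have td : Re (t * inner v u) - Re (t * f v) = - (s * nd u ^+ 2).
    have -> : inner v u = f v - d u by rewrite /d subKr.
    rewrite mulrBr ReD addrAC subrr add0r ReN; congr (- _).
    rewrite /t -mulrA [_^* * _]mulrC -sqr_normc ndE.
    by rewrite -rmorphXn -rmorphM.
  have fuv : Re (f (u + t *: v)) = Re (f u) + Re (t * f v).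
    by rewrite [f _]linearD [f (t *: v)]linearZ -ReD.
  have := mJ (u + t *: v).
  rewrite /J ReqD (Re_innerC u) linearZl_LR/= rt fuv.
  rewrite /J ReDot in Su.
  move=> h; have n2 := sqr_ge0 (nd u).
  have : s * nd u ^+ 2 <= e.
    have : 0 <= s ^+ 2 * nd u ^+ 2 by rewrite mulr_ge0// sqr_ge0.
    have : s ^+ 2 * nd u ^+ 2 * rn v ^+ 2 = s * nd u ^+ 2 - s ^+ 2 * nd u ^+ 2.
      by rewrite -[X in X - _]mulr1 -sq; ring.
    lra.
  by rewrite /s mulrC ler_pdivrMr.
rewrite -[X in `|X|]/(d k) ndE (_ : 0 = 0%:C)// lecR.
apply/ler_addgt0Pr => e e0; rewrite add0r.
pose r := e / (2 * rn v + 1).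
have v0 := rn_ge0 v.
have p0 : 0 < 2 * rn v + 1 by lra.
have r0 : 0 < r by rewrite divr_gt0.
have Fb : F (ball k r%:C).
  by apply: Fk; apply: nbhsx_ballx; rewrite ltcR.
have FS : F (S (r ^+ 2)) by exists (r ^+ 2) => //=; rewrite exprn_gt0.
have [u [ku Su]] := filter_ex (filterI Fb FS).
move: ku; rewrite -ball_normE/= rnE ltcR => ku.
have du : nd u <= r * (rn v + 1).
  have rv0 : 0 <= r * (rn v + 1) by rewrite mulr_ge0 ?(ltW r0)//; lra.
  rewrite -(@ler_pXn2r _ 2)// ?nnegrE//.
  apply: le_trans (dS _ _ Su) _; rewrite [leRHS]exprMn.
  by apply: ler_wpM2l; [exact: sqr_ge0|nra].
have : nd k <= nd u + rn v * r.
  rewrite -lecR rmorphD rmorphM/= -!ndE.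
  have -> : d k = d u - inner v (k - u) by rewrite linearBr/= /d; ring.
  rewrite (le_trans (ler_normB _ _))// lerD2l.
  rewrite (le_trans (inner_CauchySchwarz _ _))// !rnE -!rmorphM lecR.
  by rewrite ler_wpM2l// ltW.
have -> : e = r * (2 * rn v + 1) by rewrite /r divfK// gt_eqF.
lra.
Qed.

Lemma inner_representable (T : bop H) v : 
  exists k, forall u, inner (T u) v = inner u k.
Proof.
pose g (u : H) : R[i]^o := inner (T u) v.
have lg : linear g by move=> a x y; rewrite /g linearP linearPl.
pose f : {linear H -> R[i]^o} := HB.pack g (GRing.isLinear.Build _ _ _ _ g lg).
have /riesz_representation[k fk] : continuous f.
  apply/linear_bounded_continuous/linear_boundedP.
  have /linear_boundedP := @bop_bounded _ _ T.
  move=> /pinfty_ex_gt0[M M0 TM].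
  exists (M * `|v|); split => [|N MN u]; first by rewrite realM// gtr0_real.
  rewrite (le_trans (inner_CauchySchwarz _ _))//.
  rewrite (le_trans _ (ler_wpM2r (normr_ge0 u) (ltW MN)))//.
  by rewrite mulrAC ler_wpM2r.
by exists k.
Qed.

Lemma adjoint_exists (T : bop H) :
  exists S : bop H, forall u v, inner (T u) v = inner u (S v).
Proof.
have /choice[g gE] := inner_representable T.
have lg : linear g.
  move=> a x y; apply: inner_inj => w.
  by rewrite -gE !linearPr/= !gE.
pose f : {linear H -> H} := HB.pack g (GRing.isLinear.Build _ _ _ _ g lg).
have bf : bounded_near f (nbhs (0 : H)).
  apply/linear_boundedP.
  have /linear_boundedP := @bop_bounded _ _ T.
  move=> /pinfty_ex_gt0[M M0 TM].
  exists M; split => [|N MN v]; first by rewrite gtr0_real.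
  have N0 := lt_trans M0 MN.
  have [->|gv0] := eqVneq (f v) 0; first by rewrite normr0 mulr_ge0// ltW.
  rewrite -(@ler_pM2l _ `|f v|) ?normr_gt0//.
  rewrite -expr2 -inner_norm -[inner _ _]ger0_norm ?dnorm_ge0// -gE.
  rewrite (le_trans (inner_CauchySchwarz _ _))// mulrCA mulrA ler_wpM2r//.
  by rewrite (le_trans (TM _))// ler_wpM2r// ltW.
by exists (Bop bf).
Qed.
End HilbertTheory.

Section Operators.
Variables (R : realType) (H : hilbertType R).
Implicit Types T S : bop H.

Lemma bop_continuous T : continuous T.
Proof. exact/linear_bounded_continuous/bop_bounded. Qed.

Lemma bop_comp_bounded T S :
  bounded_near (bop_fun T \o bop_fun S : {linear H -> H}) (nbhs (0 : H)).
Proof.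
apply/linear_bounded_continuous => u; apply: continuous_comp.
- exact: bop_continuous.
- exact: bop_continuous.
Qed.

Definition bop_comp T S : bop H := Bop (bop_comp_bounded T S).

Lemma bop_add_bounded T S :
  bounded_near (bop_fun T \+ bop_fun S : {linear H -> H}) (nbhs (0 : H)).
Proof.
apply/linear_bounded_continuous => u; apply: cvgD.
- exact: bop_continuous.
- exact: bop_continuous.
Qed.

Definition bop_add T S : bop H := Bop (bop_add_bounded T S).

Definition adjoint T : bop H := projT1 (cid (adjoint_exists T)).

Lemma adjointP T u v : inner (T u) v = inner u (adjoint T v).
Proof. exact: (projT2 (cid (adjoint_exists T))). Qed.

End Operators.

Section SemiHilbert.
Variables (R : realType) (H : hilbertType R).
Implicit Types (A T Y G : bop H) (V : set H).

Definition positive_op A := forall u, 0 <= inner (A u) u.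

Definition A_inner A (u v : H) : R[i] := inner (A u) v.

Definition A_norm A (u : H) : R[i] := sqrtC (A_inner A u u).

Definition in_BA A T := range (adjoint T \o A) `<=` range A.

(* Y = T^{#_A}; for A positive such a Y is unique, and it exists when in_BA A T. *)
Definition is_A_adjoint A T Y :=
  A \o Y =1 adjoint T \o A /\ range Y `<=` closure (range A).

Definition compatible A V := exists Q : bop H,
  [/\ Q \o Q =1 Q, range Q = V & A \o Q =1 adjoint Q \o A].

Definition nullspace T : set H := [set u | T u = 0].

Definition is_A_ginverse A T G :=
  [/\ T \o G \o T =1 T,
      G \o T \o G =1 G,
      A \o (T \o G) =1 adjoint (bop_comp T G) \o A &
      A \o (G \o T) =1 adjoint (bop_comp G T) \o A].

End SemiHilbert.

Section Berezin.
Variables (R : realType) (X : Type) (H : rkhsType R X).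
Implicit Types A T : bop H.
Local Open Scope ereal_scope.

Definition kernel (x : X) : H :=
  projT1 (cid (riesz_representation (eval_continuous x))).

Lemma kernelP (x : X) (u : H) : eval x u = inner u (kernel x).
Proof. exact: (projT2 (cid (riesz_representation (eval_continuous x)))). Qed.

Definition nkernel A (x : X) : H := (A_norm A (kernel x))^-1 *: kernel x.

(* The norm of R[i] takes values in R[i], hence Re. The supremum is taken in
   [0, +oo]; the added 0 only matters when A_norm A vanishes on all kernels. *)
Definition ber A T : \bar R :=
  ereal_sup (0 |`
    [set (complex.Re `|A_inner A (T (nkernel A x)) (nkernel A x)|)%:E
       | x in [set x | A_norm A (kernel x) != 0%R]]).

End Berezin.

(* Main.v *)
Require Import Defs.
From HB Require Import structures.
From mathcomp Require Import all_boot all_order all_algebra.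
From mathcomp Require Import sesquilinear complex ring.
From mathcomp Require Import all_classical all_reals all_analysis.
Import Order.TTheory GRing.Theory Num.Theory.
Import numFieldNormedType.Exports.
Local Open Scope classical_set_scope.
Local Open Scope ring_scope.

(** The pairing [A_inner A] is a positive semidefinite hermitian form, so it
    satisfies the Cauchy-Schwarz inequality even though it may be degenerate.
    Let k be a normalized kernel, so that k has A-norm 1, and write z for the
    modulus of <Zk, k>_A.

    Cauchy-Schwarz gives z^2 <= <Zk, Zk>_A = <Z^# Z k, k>_A, hence
    ber Z <= (ber (Z^# Z))^(1/2): this is [ber_le_sqrt].

    The operator P = Z Z^+ is an A-selfadjoint idempotent that fixes the range
    of Z, so <Zk, k>_A = <PZk, k>_A = <Zk, Pk>_A.  Cauchy-Schwarz and the
    arithmetic-geometric mean inequality then give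
    2z <= <Zk, Zk>_A + <Pk, Pk>_A = <(Z^# Z + P)k, k>_A, hence
    2 ber Z <= ber (Z^# Z + Z Z^+): this is [ber_double_le].

    The theorem splits (ber Z)^2 as
    (1 - eps)/2 * ber Z * (2 ber Z) + eps * (ber Z)^2; in the first summand one
    factor is bounded by each of the two estimates, and the second summand by
    the first estimate squared.  Every quantity is nonnegative, so the
    computation remains valid when a Berezin number is infinite. *)

Section SemiInner.
Set Implicit Arguments.
Unset Strict Implicit.
Variables (R : realType) (H : hilbertType R).
Implicit Types A T Y G : bop H.

Lemma A_innerDl A u v w : A_inner A (u + v) w = A_inner A u w + A_inner A v w.
Proof. by rewrite /A_inner linearD linearDl. Qed.

Lemma A_innerDr A u v w : A_inner A u (v + w) = A_inner A u v + A_inner A u w.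
Proof. by rewrite /A_inner linearDr. Qed.

Lemma A_innerZl A c u v : A_inner A (c *: u) v = c * A_inner A u v.
Proof. by rewrite /A_inner linearZ linearZl_LR. Qed.

Lemma A_innerZr A c u v : A_inner A u (c *: v) = c^* * A_inner A u v.
Proof. by rewrite /A_inner linearZr_LR. Qed.

Lemma A_inner_sqrDZ A u v c :
  A_inner A (u + c *: v) (u + c *: v) =
  A_inner A u u + `|c| ^+ 2 * A_inner A v v +
    (c^* * A_inner A u v + c * A_inner A v u).
Proof.
by rewrite !A_innerDl !A_innerDr !(A_innerZl, A_innerZr) normCK; ring.
Qed.

(** The polarization argument: the form being real on u + c v, the cross term
    is real for every scalar c, and c = 1 and c = i determine it. *)
Lemma A_innerC A u v : positive_op A -> A_inner A u v = (A_inner A v u)^*.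
Proof.
move=> pA; set a := A_inner A u v; set b := A_inner A v u.
have ab (c : R[i]) : (c^* * a + c * b)^* = c^* * a + c * b.
  apply: conj_Creal; have := ger0_real (pA (u + c *: v)).
  rewrite -/(A_inner A _ _) A_inner_sqrDZ rpredDl// ger0_real// addr_ge0 //.
    exact: pA.
  by rewrite mulr_ge0 ?exprn_ge0 //; exact: pA.
have := ab 'i; have := ab 1.
rewrite !rmorphD !rmorphM /= !conjCK conjCi rmorph1 !mul1r => e1.
rewrite !mulNr => ei.
have e2 : a^* - b^* = b - a.
  by apply: (mulfI (neq0Ci R[i])); rewrite mulrBr ei; ring.
apply: (mulfI (_ : 2 != 0 :> R[i])); first by rewrite pnatr_eq0.
transitivity (a + b - (b - a)); first by ring.
by rewrite -e1 -e2; ring.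
Qed.

(** The form is evaluated at u - t a v, where a = <u, v>_A and t >= 0.  The
    minimizing choice is t = 1 / <v, v>_A; when <v, v>_A = 0, a large t forces
    a = 0. *)
Lemma A_CauchySchwarz A u v : positive_op A ->
  `|A_inner A u v| ^+ 2 <= A_inner A u u * A_inner A v v.
Proof.
move=> pA; set a := A_inner A u v.
have q (t : R[i]) : 0 <= t ->
    2 * t * `|a| ^+ 2 <= A_inner A u u + t ^+ 2 * `|a| ^+ 2 * A_inner A v v.
  move=> t0; have := pA (u + (- (t * a)) *: v).
  rewrite -/(A_inner A _ _) A_inner_sqrDZ (A_innerC v u pA) -/a.
  rewrite normrN normrM (ger0_norm t0) rmorphN rmorphM /= (geC0_conj t0).
  set X := (X in 0 <= X) => X0; rewrite -subr_ge0; congr (is_true (0 <= _)): X0.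
  by rewrite /X exprMn normCK; ring.
have := pA v; rewrite le0r => /orP[/eqP v0|v0].
  rewrite -/(A_inner A v v) in v0; rewrite v0 mulr0.
  have [->//|a0] := eqVneq (`|a| ^+ 2) 0.
  have pu := pA u.
  (* With this t the inequality q reads 2 (<u, u>_A + 1) <= <u, u>_A. *)
  have t0 : 0 <= (A_inner A u u + 1) / `|a| ^+ 2.
    by rewrite divr_ge0 ?exprn_ge0 // addr_ge0.
  have := q _ t0; rewrite v0 mulr0 addr0 mulrA divfK// => h.
  have : A_inner A u u + 2 <= 0.
    rewrite -(lerD2l (A_inner A u u)) addr0; apply: le_trans h.
    by rewrite le_eqVlt; apply/orP; left; apply/eqP; ring.
  by move/(lt_le_trans (ltr_wpDl pu (ltr0n _ 2))); rewrite ltxx.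
rewrite -/(A_inner A v v) in v0 *.
have vi : 0 <= (A_inner A v v)^-1 by rewrite invr_ge0 ltW.
have := q _ vi; rewrite -(ler_pM2r v0) -subr_ge0 => h.
rewrite -subr_ge0; apply: le_trans h _.
by rewrite le_eqVlt; apply/orP; left; apply/eqP; field; rewrite gt_eqF.
Qed.

Lemma adjointP_sym T u v : inner (adjoint T u) v = inner u (T v).
Proof.
rewrite (hermC inner _ v) /= expr0 mul1r -adjointP.
by rewrite (hermC inner u) /= expr0 mul1r.
Qed.

Lemma A_adjointP A T Y u v : is_A_adjoint A T Y ->
  A_inner A (Y u) v = A_inner A u (T v).
Proof. by move=> [/(_ u) /= e _]; rewrite /A_inner e adjointP_sym. Qed.

Lemma A_ginverse_selfadjoint A T G u v : is_A_ginverse A T G ->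
  A_inner A (T (G u)) v = A_inner A u (T (G v)).
Proof. by case=> _ _ /(_ u) /= e _; rewrite /A_inner e adjointP_sym. Qed.

(** T G is idempotent and A-selfadjoint, so <TGu, u>_A = <TGTGu, u>_A can be
    folded back. *)
Lemma A_ginverse_proj A T G u : is_A_ginverse A T G ->
  A_inner A (T (G u)) u = A_inner A (T (G u)) (T (G u)).
Proof.
by move=> AG; rewrite -(A_ginverse_selfadjoint _ _ AG); case: AG => /(_ (G u)) /= ->.
Qed.

(** T G fixes the range of T, and moves to the other side of the form. *)
Lemma A_ginverse_range A T G u v : is_A_ginverse A T G ->
  A_inner A (T u) v = A_inner A (T u) (T (G v)).
Proof.
by move=> AG; rewrite -(A_ginverse_selfadjoint _ _ AG); case: AG => /(_ u) /= ->.
Qed.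

(** Cauchy-Schwarz for T k and the A-unit vector k. *)
Lemma A_numeric_sqr_le A T Y k : positive_op A -> is_A_adjoint A T Y ->
  A_inner A k k = 1 ->
  `|A_inner A (T k) k| ^+ 2 <= `|A_inner A (bop_comp Y T k) k|.
Proof.
move=> pA AT k1; rewrite /= (A_adjointP _ _ AT) (ger0_norm (pA _)).
by rewrite (le_trans (A_CauchySchwarz _ _ pA))// k1 mulr1.
Qed.

(** Both sides are squared: with a = <Tk, Tk>_A and p = <TGk, TGk>_A, the modulus
    of <Tk, k>_A = <Tk, TGk>_A is at most the geometric mean of a and p, and the
    right-hand side is a + p. *)
Lemma A_numeric_double_le A T Y G k : positive_op A -> is_A_adjoint A T Y ->
  is_A_ginverse A T G ->
  2 * `|A_inner A (T k) k| <=
  `|A_inner A (bop_add (bop_comp Y T) (bop_comp T G) k) k|.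
Proof.
move=> pA AT AG; rewrite /= A_innerDl (A_adjointP _ _ AT) (A_ginverse_proj _ AG).
set a := A_inner A (T k) (T k); set p := A_inner A (T (G k)) _.
have a0 : 0 <= a by exact: pA.
have p0 : 0 <= p by exact: pA.
have ap0 : 0 <= a + p by rewrite addr_ge0.
rewrite (ger0_norm ap0) -(@ler_pXn2r _ 2)// ?nnegrE ?mulr_ge0//.
rewrite (A_ginverse_range _ _ AG) exprMn.
have h : 2 ^+ 2 * (a * p) <= (a + p) ^+ 2.
  rewrite -subr_ge0; have -> : (a + p) ^+ 2 - 2 ^+ 2 * (a * p) = (a - p) ^+ 2.
    by ring.
  by rewrite real_exprn_even_ge0// rpredB ?ger0_real.
by apply: le_trans h; rewrite ler_wpM2l ?exprn_ge0// A_CauchySchwarz.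
Qed.

End SemiInner.

Section Berezin.
Set Implicit Arguments.
Unset Strict Implicit.
Variables (R : realType) (X : Type) (H : rkhsType R X).
Implicit Types A T S : bop H.

Lemma nkernel_unit A x : positive_op A -> A_norm A (Defs.kernel H x) != 0 ->
  A_inner A (nkernel A x) (nkernel A x) = 1.
Proof.
move=> pA; rewrite /nkernel; set n := A_norm A (Defs.kernel H x) => n0.
have nr : 0 <= n by rewrite sqrtC_ge0; exact: pA.
rewrite A_innerZl A_innerZr geC0_conj ?invr_ge0//.
rewrite -[A_inner _ _ _]sqrtCK -/(A_norm _ _) -/n.
by field.
Qed.

Local Open Scope ereal_scope.

Lemma ber_ge0 A T : 0 <= ber A T.
Proof. by apply: ereal_sup_ubound; left. Qed.

(** The bound must be nonnegative because 0 is among the values whose supremum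
    defines [ber]. *)
Lemma ber_le A T (b : \bar R) : 0 <= b ->
  (forall x, (A_norm A (Defs.kernel H x) != 0)%R ->
    (complex.Re `|A_inner A (T (nkernel A x)) (nkernel A x)|)%:E <= b) ->
  ber A T <= b.
Proof.
move=> b0 h; apply: ge_ereal_sup => _ [->//|[x x0 <-]]; exact: h.
Qed.

Lemma le_ber A T x : (A_norm A (Defs.kernel H x) != 0)%R ->
  (complex.Re `|A_inner A (T (nkernel A x)) (nkernel A x)|)%:E <= ber A T.
Proof. by move=> x0; apply: ereal_sup_ubound; right; exists x. Qed.


Lemma ber_le_sqrt A T Y : positive_op A -> is_A_adjoint A T Y ->
  ber A T <= sqrte (ber A (bop_comp Y T)).
Proof.
move=> pA AT; apply: ber_le => [|x x0]; first exact: sqrte_ge0.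
rewrite -lee_sqr ?sqrte_ge0//; last first.
  by rewrite lee_fin -ler0c RRe_real ?normr_real.
rewrite sqr_sqrte ?ber_ge0//; apply: le_trans (le_ber _ x0).
rewrite -EFin_expe lee_fin -lecR rmorphXn !RRe_real ?normr_real//.
by apply: A_numeric_sqr_le => //; exact: nkernel_unit.
Qed.

Lemma ber_double_le A T Y G : positive_op A -> is_A_adjoint A T Y ->
  is_A_ginverse A T G ->
  2%:E * ber A T <= ber A (bop_add (bop_comp Y T) (bop_comp T G)).
Proof.
move=> pA AT AG; rewrite -lee_pdivlMl//; apply: ber_le => [|x x0].
  by rewrite mule_ge0 ?ber_ge0// lee_fin.
rewrite lee_pdivlMl//; apply: le_trans (le_ber _ x0).
rewrite -EFinM lee_fin -lecR rmorphM !RRe_real ?normr_real// rmorph_nat.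
exact: A_numeric_double_le.
Qed.

End Berezin.

Theorem theorem2p2 (R : realType) (X : Type) (H : rkhsType R X)
    (A Z Zs Zd : bop H) (eps : R) :
  inhabited X ->
  positive_op A ->
  in_BA A Z ->
  closed (range Z) ->
  compatible A (range Z) ->
  compatible A (nullspace Z) ->
  is_A_adjoint A Z Zs ->
  is_A_ginverse A Z Zd ->
  0 <= eps <= 1 ->
  (ber A Z ^+ 2 <=
    ((1 - eps) / 2)%:E * ber A (bop_comp Zs Z) `^ (2^-1)
      * ber A (bop_add (bop_comp Zs Z) (bop_comp Z Zd))
    + eps%:E * ber A (bop_comp Zs Z))%E.
Proof.
move=> _ pA _ _ _ _ AZ AG /andP[e0 e1].
have e1' : 0 <= 1 - eps by rewrite subr_ge0.
rewrite poweR12_sqrt ?ber_ge0//.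
have hB := ber_le_sqrt pA AZ; have hC := ber_double_le pA AZ AG.
have m0 := ber_ge0 A Z.
have -> : (ber A Z ^+ 2 =
    ((1 - eps) / 2)%:E * ber A Z * (2%:E * ber A Z) + eps%:E * ber A Z ^+ 2)%E.
  rewrite muleACA -EFinM divfK ?pnatr_eq0// -[(ber A Z * ber A Z)%E]expe2.
  by rewrite -ge0_muleDl ?lee_fin// -EFinD subrK mul1e.
apply: leeD.
  apply: lee_pmul => //; rewrite ?mule_ge0 ?lee_fin ?divr_ge0//.
  by apply: lee_wpmul2l; rewrite ?lee_fin ?divr_ge0.
apply: lee_wpmul2l; rewrite ?lee_fin//.
by rewrite -[leRHS]sqr_sqrte ?ber_ge0// lee_sqr ?sqrte_ge0.
Qed.
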